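(* Let $\mathcal{U}$ be a Hilbert space, $\mathbb{J}\subset\mathbb{Z}$, $\{\mathcal{V}_j: j\in\mathbb{J}\}$ a sequence of Hilbert spaces, and let $\{\Lambda_j\in\mathcal{L}(\mathcal{U},\mathcal{V}_j): j\in\mathbb{J}\}$ be a g-frame for $\mathcal{U}$ with respect to $\{\mathcal{V}_j: j\in\mathbb{J}\}$ with lower and upper frame bounds $A$ and $B$. Then the series $Sf=\sum_{j\in\mathbb{J}}\Lambda_j^*\Lambda_jf$ converges for every $f\in\mathcal{U}$, and $S$ is a bounded self-adjoint invertible operator on $\mathcal{U}$ with $\|S\|\le B$ and $\|S^{-1}\|\le 1/A$. Put $\tilde\Lambda_j=\Lambda_jS^{-1}$ for $j\in\mathbb{J}$. Then: (a) for every $f\in\mathcal{U}$, $$f=\sum_{j\in\mathbb{J}}\Lambda_j^*\tilde\Lambda_jf=\sum_{j\in\mathbb{J}}\tilde\Lambda_j^*\Lambda_jf;$$ (b) $\{\tilde\Lambda_j: j\in\mathbb{J}\}$ is a g-frame for $\mathcal{U}$ with respect to $\{\mathcal{V}_j: j\in\mathbb{J}\}$ with lower and upper frame bounds $1/B$ and $1/A$; (c) the g-frame operator $\tilde S$ of $\{\tilde\Lambda_j: j\in\mathbb{J}\}$, defined by $\tilde Sf=\sum_{j\in\mathbb{J}}\tilde\Lambda_j^*\tilde\Lambda_jf$, equals $S^{-1}$, and $\tilde\Lambda_j\tilde S^{-1}=\Lambda_j$ for all $j\in\mathbb{J}$.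
   Context: $\mathcal{L}(\mathcal{U},\mathcal{V}_j)$ is the space of bounded linear operators from $\mathcal{U}$ to $\mathcal{V}_j$. A sequence $\{\Lambda_j\in\mathcal{L}(\mathcal{U},\mathcal{V}_j): j\in\mathbb{J}\}$ is a g-frame for $\mathcal{U}$ with respect to $\{\mathcal{V}_j\}$ with lower and upper frame bounds $A,B>0$ if $A\|f\|^2\le\sum_{j\in\mathbb{J}}\|\Lambda_jf\|^2\le B\|f\|^2$ for all $f\in\mathcal{U}$. Series over $\mathbb{J}$ of elements of $\mathcal{U}$ converge in norm, as limits of the partial sums over $j\in\mathbb{J}$, $n_1\le j\le n_2$. *)

(* Defs.v *)
From HB Require Import structures.
From mathcomp Require Import all_boot all_order all_algebra.
From mathcomp Require Import sesquilinear.
From mathcomp Require Import complex.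
From mathcomp Require Import all_classical all_reals all_analysis.

Set Implicit Arguments.
Unset Strict Implicit.
Unset Printing Implicit Defensive.

Import Order.TTheory GRing.Theory Num.Theory.
Import numFieldNormedType.Exports.

Local Open Scope classical_set_scope.
Local Open Scope ring_scope.

(** Hilbert spaces are taken over the real or over the complex numbers. *)
Variant scalar_kind := RealScalars | ComplexScalars.

Definition scalars (R : realType) (k : scalar_kind) : numFieldType :=
  match k with
  | RealScalars => R
  | ComplexScalars => R[i]
  end.

Definition sconj (R : realType) (k : scalar_kind) :
    scalars R k -> scalars R k :=
  match k with
  | RealScalars => fun x => x
  | ComplexScalars => fun x => conjc x
  end.

Definition sre (R : realType) (k : scalar_kind) : scalars R k -> R :=
  match k with
  | RealScalars => fun x => x
  | ComplexScalars => fun x => complex.Re x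
  end.

(** [inner] is linear in its first argument and conjugate-linear in the
    second one; the library norm [`|u|] takes its values in the scalars. *)
HB.mixin Record CompleteNormedModule_isHilbert (R : realType)
    (k : scalar_kind) U & CompleteNormedModule (scalars R k) U := {
  inner : {dot U for @sconj R k} ;
  inner_norm : forall u : U, `|u| ^+ 2 = inner u u
}.

#[short(type="hilbertType")]
HB.structure Definition Hilbert (R : realType) (k : scalar_kind) :=
  { U of CompleteNormedModule_isHilbert R k U &
         CompleteNormedModule (scalars R k) U }.

Section Operators.
Context {R : realType} {k : scalar_kind}.

(** The norm as an element of [R]. *)
Definition hnorm {U : hilbertType R k} (u : U) : R := sre `|u|.

Definition bounded_operator {U V : hilbertType R k} (T : U -> V) : Prop :=
  linear T /\ bounded_near T (nbhs (0 : U)).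

Definition operator_norm {U V : hilbertType R k} (T : U -> V) : R :=
  sup [set hnorm (T u) | u in [set u : U | hnorm u <= 1]].

(** [adjoint T v] is the vector [w] representing the functional
    [u |-> inner (T u) v]; it exists, and is unique, when [T] is a bounded
    operator. *)
Definition adjoint {U V : hilbertType R k} (T : U -> V) (v : V) : U :=
  xget 0 [set w : U | forall u : U, inner (T u) v = inner u w].

Definition self_adjoint {U : hilbertType R k} (T : U -> U) : Prop :=
  forall u v : U, inner (T u) v = inner u (T v).

Definition invertible_operator {U : hilbertType R k} (T : U -> U) : Prop :=
  exists T' : U -> U, [/\ bounded_operator T', cancel T T' & cancel T' T].

(** The inverse of [T], meaningful when [T] is bijective. *)
Definition operator_inv {U : hilbertType R k} (T : U -> U) (v : U) : U :=
  xget 0 [set u : U | T u = v].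

End Operators.

Section Series.
Context {K : numFieldType} {W : normedModType K} {J : set int}.

Definition partial_sum (x : J -> W) (n1 n2 : int) : W :=
  \sum_(j \in [set j : J | n1 <= val j <= n2]) x j.

(** Sums over [J] are limits of the partial sums over [n1 <= j <= n2] as
    [n1] tends to -oo and [n2] to +oo independently; the pair [(m, n)] of
    natural numbers stands for [n1 = - m] and [n2 = n]. *)
Definition partial_sums (x : J -> W) (mn : nat * nat) : W :=
  partial_sum x (- mn.1%:Z) mn.2%:Z.

Definition has_sum (x : J -> W) (s : W) : Prop :=
  partial_sums x @ filter_prod \oo \oo --> s.

Definition summable_series (x : J -> W) : Prop :=
  cvg (partial_sums x @ filter_prod \oo \oo).

Definition series_sum (x : J -> W) : W :=
  lim (partial_sums x @ filter_prod \oo \oo).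

End Series.

Section GFrames.
Context {R : realType} {k : scalar_kind} {U : hilbertType R k} {J : set int}
  {V : J -> hilbertType R k}.

Definition gframe (L : forall j : J, U -> V j) (A B : R) : Prop :=
  [/\ 0 < A, 0 < B, forall j : J, bounded_operator (L j) &
      forall f : U, exists2 s : R,
        has_sum (fun j : J => hnorm (L j f) ^+ 2) s &
        A * hnorm f ^+ 2 <= s <= B * hnorm f ^+ 2].

Definition gframe_operator (L : forall j : J, U -> V j) (f : U) : U :=
  series_sum (fun j : J => adjoint (L j) (L j f)).

End GFrames.

(* Main.v *)
From HB Require Import structures.
Require Import Defs.
From mathcomp Require Import all_boot all_order all_algebra.
From mathcomp Require Import complex.
From mathcomp Require Import all_classical all_reals all_analysis.
From mathcomp Require Import ring lra zify.

Import Order.TTheory GRing.Theory Num.Theory.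
Import numFieldNormedType.Exports.

Local Open Scope classical_set_scope.
Local Open Scope ring_scope.

(** The form [inner (S f) g] is the sum of the [inner (L j f) (L j g)], so the
frame inequalities say exactly that [S] is symmetric with [A <= S <= B] as
quadratic forms; everything follows from this, and from two facts that turn
forms into vectors.

Convergence. For a finite set [D] of indices let [w] be the sum of the
[adjoint (L j) (L j f)] over [D]. Then [hnorm w ^+ 2] is the sum over [D] of
the products of [L j f] and [L j w]; by the arithmetic-geometric mean
inequality with weight [B], and because the squares [hnorm (L j w) ^+ 2] add
up to at most [B * hnorm w ^+ 2], it is at most [B] times the sum over [D] of
[hnorm (L j f) ^+ 2] (lemma [bessel]). Hence the series for [S f] is Cauchy
because the numerical series of the squares converges, and in the limit
[hnorm (S f) ^+ 2 <= B * ip (S f) f] ([gframe_operator_sqr_le]). This one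
inequality gives both the norm bound of [S] and the lower bound of the dual
frame.

Representation. A symmetric coercive operator [T] represents every bounded
functional as [ip (T w)] ([lax_milgram]): a minimising sequence of the energy
[ip (T u) u / 2 - phi u] is Cauchy by the parallelogram law, and its limit is
the representing vector. For the identity this is the Riesz theorem, which
makes adjoints exist ([ip_adjoint]); for [S], which is coercive with constant
[A], it is surjectivity. So [S] is bijective and its inverse has norm at most
[1 / A].

The rest is algebra: the adjoint of [L j \o Sinv] is [Sinv \o adjoint (L j)]
([adjoint_dual]), hence the reconstruction series and the series of the
dual frame operator are the series of [S], evaluated at [Sinv f] or transformed
termwise by the continuous operator [Sinv], or both.

Real and complex scalars are treated together by working with the real part
[ip] of the inner product. Nothing is lost: an equality of real parts which is
linear in a free vector upgrades to the full equality ([ip_inner_adjoint]). *)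

(** * Real and complex scalars *)

Definition rscalar (R : realType) (k : scalar_kind) : R -> scalars R k :=
  match k with
  | RealScalars => fun x => x
  | ComplexScalars => fun x => (x%:C)%C
  end.
Arguments rscalar {R k}.

Section Scalars.
Context {R : realType} {k : scalar_kind}.
Implicit Types (x y : R) (z t : scalars R k).

Lemma sreD z t : sre (z + t) = sre z + sre t.
Proof. by case: k z t => //= -[a b] [c d]. Qed.

Lemma sre_rscalarM x z : sre (rscalar x * z) = x * sre z.
Proof. by case: k z => //= -[a b] /=; rewrite mul0r subr0. Qed.

Lemma rscalarK x : sre (rscalar x : scalars R k) = x.
Proof. by case: k. Qed.

Lemma rscalarM x y : rscalar (x * y) = rscalar x * rscalar y :> scalars R k.
Proof. by case: k => //=; rewrite rmorphM. Qed.

Lemma rscalarN1 : rscalar (- 1) = - 1 :> scalars R k.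
Proof. by case: k => //=; rewrite rmorphN1. Qed.

Lemma sre_ge0K {z} : 0 <= z -> rscalar (sre z) = z.
Proof. by case: k z => //= z z0; rewrite RRe_real// ger0_real. Qed.

Lemma ler_rscalar x y : (rscalar x <= rscalar y :> scalars R k) = (x <= y).
Proof. by case: k => //=; rewrite lecR. Qed.

Lemma ltr_rscalar x y : (rscalar x < rscalar y :> scalars R k) = (x < y).
Proof. by case: k => //=; rewrite ltcR. Qed.

Lemma rscalar0 : rscalar 0 = 0 :> scalars R k.
Proof. by case: k. Qed.

Lemma sre_conj z : sre (sconj z) = sre z.
Proof. by case: k z => //= -[]. Qed.

Lemma sconjK z : sconj (sconj z) = z.
Proof. by case: k z => //= z; rewrite conjcK. Qed.

Lemma sre_conjM_eq0 {z} : sre (sconj z * z) = 0 -> z = 0.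
Proof.
case: k z => [z /eqP|[a b]] /=; first by rewrite mulf_eq0 orbb => /eqP.
rewrite mulNr opprK => /eqP; rewrite paddr_eq0 ?sqr_ge0 -?expr2 ?sqr_ge0//.
by rewrite !sqrf_eq0 => /andP[/eqP -> /eqP ->].
Qed.

End Scalars.

(** * The underlying real inner product *)

Definition ip {R : realType} {k : scalar_kind} {U : hilbertType R k} (u v : U) :
    R :=
  sre (inner u v).

Section RealInner.
Context {R : realType} {k : scalar_kind} {U : hilbertType R k}.
Implicit Types (u v w : U) (a : R).

Lemma ipC u v : ip u v = ip v u.
Proof. by rewrite /ip (hermitian_subproof u v) expr0 mul1r sre_conj. Qed.

Lemma ipDl u v w : ip (u + v) w = ip u w + ip v w.
Proof. by rewrite /ip linearDl sreD. Qed.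

Lemma ipDr u v w : ip w (u + v) = ip w u + ip w v.
Proof. by rewrite ipC ipDl !(ipC _ w). Qed.

Lemma ipZl a u v : ip (rscalar a *: u) v = a * ip u v.
Proof. by rewrite /ip linearZl_LR sre_rscalarM. Qed.

Lemma ipZr a u v : ip v (rscalar a *: u) = a * ip v u.
Proof. by rewrite ipC ipZl ipC. Qed.

Lemma ipNl u v : ip (- u) v = - ip u v.
Proof. by rewrite -scaleN1r -rscalarN1 ipZl mulN1r. Qed.

Lemma ipNr u v : ip v (- u) = - ip v u.
Proof. by rewrite ipC ipNl ipC. Qed.

Lemma ip0l v : ip 0 v = 0.
Proof. by rewrite -[X in ip X _](scale0r (0 : U)) -rscalar0 ipZl mul0r. Qed.

Lemma ip0r v : ip v 0 = 0.
Proof. by rewrite ipC ip0l. Qed.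

Definition ipE := (ipDl, ipDr, ipNl, ipNr, ipZl, ipZr).

Lemma normr_hnorm u : `|u| = rscalar (hnorm u).
Proof. by rewrite /hnorm sre_ge0K. Qed.

Lemma hnorm_ge0 u : 0 <= hnorm u.
Proof. by rewrite -(ler_rscalar (k:=k)) -normr_hnorm rscalar0. Qed.

Lemma hnorm_sqr u : hnorm u ^+ 2 = ip u u.
Proof.
rewrite /ip -inner_norm normr_hnorm -{1}[hnorm u](rscalarK (k:=k)) !expr2.
by rewrite sre_rscalarM rscalarK.
Qed.

Lemma ip_ge0 u : 0 <= ip u u.
Proof. by rewrite -hnorm_sqr sqr_ge0. Qed.

Lemma hnorm_eq0 {u} : hnorm u = 0 -> u = 0.
Proof. by move=> u0; apply/eqP; rewrite -normr_eq0 normr_hnorm u0 rscalar0. Qed.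

Lemma hnorm_opp u : hnorm (- u) = hnorm u.
Proof. by rewrite /hnorm normrN. Qed.

Lemma hnorm_triangle u v : hnorm (u + v) <= hnorm u + hnorm v.
Proof.
rewrite -(ler_rscalar (k:=k)) -normr_hnorm (le_trans (ler_normD u v))//.
by rewrite !normr_hnorm; case: k (hnorm u) (hnorm v) => //= x y; rewrite rmorphD.
Qed.

(** Cauchy-Schwarz, from the positivity of the square of [|v| u - |u| v]. *)
Lemma ip_le u v : ip u v <= hnorm u * hnorm v.
Proof.
have := ip_ge0 (rscalar (hnorm v) *: u - rscalar (hnorm u) *: v).
have [/hnorm_eq0 ->|u0] := eqVneq (hnorm u) 0.
  by rewrite ip0l mulr_ge0 ?hnorm_ge0.
have [/hnorm_eq0 ->|v0] := eqVneq (hnorm v) 0.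
  by rewrite ip0r mulr_ge0 ?hnorm_ge0.
rewrite !ipE (ipC v u) -!hnorm_sqr => h.
have uv0 : 0 < hnorm u * hnorm v by rewrite mulr_gt0// lt_def ?u0 ?v0 hnorm_ge0.
rewrite -(ler_pM2l uv0) -subr_ge0; lra.
Qed.

Lemma ip_abs_le u v : `|ip u v| <= hnorm u * hnorm v.
Proof.
by rewrite ler_norml ip_le andbT lerNl -ipNl -(hnorm_opp u) ip_le.
Qed.

Lemma ip_inj {v w} : (forall u, ip u v = ip u w) -> v = w.
Proof.
move=> h; apply/eqP; rewrite -subr_eq0; apply/eqP/hnorm_eq0/eqP.
by rewrite -sqrf_eq0 hnorm_sqr ipDr ipNr h subrr.
Qed.

Lemma cvg_hnormP {X : Type} {F : set_system X} {FF : Filter F} {f : X -> U} {w} :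
  f @ F --> w <-> forall e : R, 0 < e -> \forall x \near F, hnorm (w - f x) < e.
Proof.
split=> [/cvgrPdist_lt fw e e0|fw].
  have /fw : 0 < rscalar e :> scalars R k by rewrite -rscalar0 ltr_rscalar.
  by apply: filterS => x; rewrite normr_hnorm ltr_rscalar.
apply/cvgrPdist_lt => e e0; have := fw (sre e).
rewrite -(ltr_rscalar (k:=k)) sre_ge0K ?ltW// rscalar0 => /(_ e0).
by apply: filterS => x; rewrite normr_hnorm -(ltr_rscalar (k:=k)) sre_ge0K ?ltW.
Qed.

Lemma cvg_ip {X : Type} {F : set_system X} {FF : Filter F} {f : X -> U} {w} v :
  f @ F --> w -> ip (f x) v @[x --> F] --> ip w v.
Proof.
move=> /cvg_hnormP fw; apply/cvgrPdist_lt => e e0.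
have c0 : 0 < hnorm v + 1 by rewrite ltr_wpDl ?hnorm_ge0.
have := fw (e / (hnorm v + 1)); rewrite divr_gt0// => /(_ isT).
apply: filterS => x; rewrite ltr_pdivlMr// => h.
rewrite -ipNl -ipDl (le_lt_trans (ip_abs_le _ _))// (le_lt_trans _ h)//.
by rewrite ler_wpM2l ?hnorm_ge0// lerDl.
Qed.

Lemma hnorm_cauchy_cvg {X : Type} {F : set_system X} {FF : ProperFilter F} {f : X -> U} :
  (forall e : R, 0 < e -> exists w, \forall x \near F, hnorm (w - f x) < e) ->
  cvg (f @ F).
Proof.
move=> h; apply/cauchy_cvgP/cauchy_exP => e e0.
have := h (sre e); rewrite -(ltr_rscalar (k:=k)) sre_ge0K ?ltW// rscalar0 => /(_ e0)[w hw].
exists w; apply: filterS hw => x hx.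
by rewrite /= -ball_normE /= normr_hnorm -(sre_ge0K (ltW e0)) ltr_rscalar.
Qed.

End RealInner.

(** * Representation of functionals by a coercive symmetric operator *)

Section LaxMilgram.
Context {R : realType} {k : scalar_kind} {U : hilbertType R k}.
Variables (T : U -> U) (c : R) (phi : U -> R) (C : R).
Hypothesis TD : forall u v, T (u + v) = T u + T v.
Hypothesis TZ : forall a u, T (rscalar a *: u) = rscalar a *: T u.
Hypothesis Tsym : forall u v, ip (T u) v = ip u (T v).
Hypothesis c_gt0 : 0 < c.
Hypothesis Tc : forall u, c * hnorm u ^+ 2 <= ip (T u) u.
Hypothesis phiD : forall u v, phi (u + v) = phi u + phi v.
Hypothesis phiZ : forall a u, phi (rscalar a *: u) = a * phi u.
Hypothesis phiC : forall u, `|phi u| <= C * hnorm u.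

(** The solution of [T w = phi] is sought as the minimiser of the energy. *)
Let energy u := ip (T u) u / 2 - phi u.

Let energy_lb : has_lbound (range energy).
Proof.
exists (- (C ^+ 2 / (2 * c))) => _ [u _ <-]; rewrite /energy.
have h1 := Tc u; have h2 := le_trans (ler_norm _) (phiC u).
suff : 0 <= c * hnorm u ^+ 2 / 2 - C * hnorm u + C ^+ 2 / (2 * c) by lra.
have -> : c * hnorm u ^+ 2 / 2 - C * hnorm u + C ^+ 2 / (2 * c) =
          (c * hnorm u - C) ^+ 2 / (2 * c) by field; rewrite gt_eqF.
by rewrite divr_ge0 ?sqr_ge0// mulr_ge0// ltW.
Qed.

Let energy_inf : has_inf (range energy).
Proof. by split; [exists (energy 0), 0|exact: energy_lb]. Qed.

Let m := inf (range energy).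

Let m_le u : m <= energy u.
Proof. by apply: ge_inf; [exact: energy_lb|exists u]. Qed.

(** Parallelogram law: two points of nearly minimal energy are close, as their
midpoint has energy at least [m]. *)
Let near_min_dist {u v d} : energy u <= m + d -> energy v <= m + d ->
  c * hnorm (u - v) ^+ 2 <= 8 * d.
Proof.
move=> ud vd; apply: le_trans (Tc _) _.
have := m_le (rscalar 2^-1 *: (u + v)).
have -> : ip (T (u - v)) (u - v) =
    2 * ip (T u) u + 2 * ip (T v) v - ip (T (u + v)) (u + v).
  rewrite -[- v]scale1r scalerN -scaleNr -rscalarN1 !TD TZ !ipE.
  by rewrite (Tsym v u) (ipC v); ring.
by move: ud vd; rewrite /energy !TZ !phiZ !phiD !ipE; lra.
Qed.

(** First-order condition at a point of nearly minimal energy: perturbing it in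
the direction [h] cannot lower the energy by more than [d], so the derivative
[e] in that direction is small. *)
Let near_min_residual {u} h {d} : energy u <= m + d ->
  (ip (T u) h - phi h) ^+ 2 <= 2 * d * (ip (T h) h + 1).
Proof.
move=> ud; set q := ip (T h) h.
have q0 : 0 <= q by apply: le_trans (Tc h); rewrite mulr_ge0 ?sqr_ge0// ltW.
set e := _ - _.
have energyE s : energy (u + rscalar s *: h) = energy u + s * e + s ^+ 2 * q / 2.
  by rewrite /energy /e /q TD TZ phiD phiZ !ipE (Tsym h u) (ipC h (T u)); field.
(* The step minimises the quadratic upper bound of the energy; [q + 1]
   replaces [q] to keep the denominator positive when [q = 0]. *)
have := m_le (u + rscalar (- (e / (q + 1))) *: h); rewrite energyE.
set t := - (e / (q + 1)).
move=> mt; have : 0 <= d + t * e + t ^+ 2 * (q + 1) / 2.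
  have := sqr_ge0 t; lra.
have -> : d + t * e + t ^+ 2 * (q + 1) / 2 = (2 * d * (q + 1) - e ^+ 2) / (2 * (q + 1)).
  by rewrite /t; field; rewrite gt_eqF// ltr_wpDl.
by rewrite pmulr_lge0 ?subr_ge0// invr_gt0 mulr_gt0// ltr_wpDl.
Qed.

(** Near-minimisers form a Cauchy sequence, and their residuals tend to 0. The
residuals pass to the limit by the symmetry of [T]: [ip (T (x n)) h] is
[ip (x n) (T h)], which converges with [x n]. *)
Lemma lax_milgram : exists w, forall u, ip (T w) u = phi u.
Proof.
have min_seq n : exists u, energy u <= m + harmonic n.
  have [_ [u _ <-] /ltW ud] := inf_adherent (@harmonic_gt0 R n) energy_inf.
  by exists u.
pose x n := projT1 (cid (min_seq n)).
have xP n : energy (x n) <= m + harmonic n by rewrite /x; case: cid.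
have x_cvg : cvg (x @ \oo).
  apply: hnorm_cauchy_cvg => e e0.
  have ce0 : 0 < c * e ^+ 2 / 8 by rewrite divr_gt0// mulr_gt0// exprn_gt0.
  have /cvgrPdist_lt /(_ _ ce0) [N _ hN] := @cvg_harmonic R.
  exists (x N); exists N => // n /= Nn.
  have := hN N (leqnn N); rewrite /= sub0r normrN gtr0_norm ?harmonic_gt0// => hNe.
  have xnN : energy (x n) <= m + harmonic N.
    apply: le_trans (xP n) _; rewrite lerD2l /harmonic lef_pV2 ?posrE ?ltr0n//.
    by rewrite ler_nat ltnS.
  have hle := near_min_dist (xP N) xnN.
  rewrite -(@ltr_pXn2r _ 2) ?nnegrE ?hnorm_ge0 ?(ltW e0)//.
  rewrite -(ltr_pM2l c_gt0); apply: le_lt_trans hle _.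
  by rewrite mulrC -ltr_pdivlMr.
exists (lim (x @ \oo)) => h; apply/eqP; rewrite -subr_eq0 -sqrf_eq0.
have res_cvg : ((ip (T (x n)) h - phi h) ^+ 2 @[n --> \oo] -->
    (ip (T (lim (x @ \oo))) h - phi h) ^+ 2).
  rewrite expr2; under eq_fun do rewrite expr2.
  have : (ip (T (x n)) h - phi h @[n --> \oo]) --> ip (T (lim (x @ \oo))) h - phi h.
    under eq_fun do rewrite Tsym.
    by rewrite Tsym; apply: cvgB; [exact: cvg_ip|exact: cvg_cst].
  by move=> hc; apply: cvgM.
rewrite eq_le sqr_ge0 andbT.
apply: (ler_cvg_to res_cvg (g := fun n => 2 * (ip (T h) h + 1) * harmonic n)).
  by rewrite -(mulr0 (2 * (ip (T h) h + 1))); apply: cvgMr; exact: cvg_harmonic.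
by apply: nearW => n; rewrite mulrAC; exact: near_min_residual.
Qed.

End LaxMilgram.

(** * Bounded operators and adjoints *)

Section Adjoint.
Context {R : realType} {k : scalar_kind}.
Implicit Types U V W : hilbertType R k.

Lemma bounded_operatorP {U V} (T : U -> V) : bounded_operator T <->
  linear T /\ exists M : R, forall u, hnorm (T u) <= M * hnorm u.
Proof.
split=> -[Tlin Tbd]; split=> //.
  pose f : {linear U -> V} := HB.pack T (GRing.isLinear.Build _ _ _ _ T Tlin).
  have /linear_boundedP/pinfty_ex_gt0[r r0 hr] : bounded_near f (nbhs (0 : U)) by [].
  exists (sre r) => u; have := hr u; rewrite /= !normr_hnorm.
  by rewrite -(sre_ge0K (ltW r0)) -rscalarM ler_rscalar rscalarK.
have [M hM] := Tbd.
pose f : {linear U -> V} := HB.pack T (GRing.isLinear.Build _ _ _ _ T Tlin).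
suff : bounded_near f (nbhs (0 : U)) by [].
apply/bounded_funP => r; exists (rscalar (`|M| * sre r)) => u ur.
have r0 : 0 <= r by apply: le_trans ur.
rewrite normr_hnorm ler_rscalar; apply: le_trans (hM u) _.
apply: (@le_trans _ _ (`|M| * hnorm u)); first by rewrite ler_wpM2r ?hnorm_ge0 ?ler_norm.
by rewrite ler_wpM2l// -(ler_rscalar (k:=k)) -normr_hnorm sre_ge0K.
Qed.

Lemma linear_add {U V} {T : U -> V} : linear T -> forall u v, T (u + v) = T u + T v.
Proof. by move=> Tlin u v; have := Tlin 1 u v; rewrite !scale1r. Qed.

Lemma linear_zero {U V} {T : U -> V} : linear T -> T 0 = 0.
Proof. by move=> /linear_add T0; apply: (addrI (T 0)); rewrite -T0 !addr0. Qed.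

Lemma linear_scale {U V} {T : U -> V} : linear T -> forall a u, T (a *: u) = a *: T u.
Proof. by move=> Tlin a u; have := Tlin a u 0; rewrite (linear_zero Tlin) !addr0. Qed.

(** The difference [d u] of both sides is linear in [u]; the hypothesis at the
vector [sconj (d u) *: u] says that [sconj (d u) * d u], which is the squared
modulus of [d u], vanishes. *)
Lemma ip_inner_adjoint {U V} {T : U -> V} {v : V} {w : U} : linear T ->
  (forall u, ip (T u) v = ip u w) -> forall u, inner (T u) v = inner u w.
Proof.
move=> Tlin h u; apply/eqP; rewrite -subr_eq0; apply/eqP/sre_conjM_eq0.
set z := sconj _; rewrite mulrBr -!linearZl_LR -(linear_scale Tlin) -mulN1r -rscalarN1.
by rewrite sreD sre_rscalarM mulN1r; apply/eqP; rewrite subr_eq0; apply/eqP/h.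
Qed.

Lemma adjoint_uniq {U V} {T : U -> V} {v : V} {w : U} : linear T ->
  (forall u, ip (T u) v = ip u w) -> adjoint T v = w.
Proof.
move=> Tlin h; rewrite /adjoint; case: xgetP => [w' _ /= hw'|/(_ w)[]].
  by apply: ip_inj => u; rewrite -h /ip hw'.
exact: ip_inner_adjoint.
Qed.

(** Riesz representation, that is, [lax_milgram] for the identity. *)
Lemma ip_adjoint {U V} {T : U -> V} : bounded_operator T ->
  forall u v, ip (T u) v = ip u (adjoint T v).
Proof.
move=> /bounded_operatorP[Tlin [M hM]] u v.
have [w hw] : exists w, forall u, ip (idfun w) u = ip (T u) v.
  apply: (@lax_milgram R k U idfun 1 (fun u => ip (T u) v) (`|M| * hnorm v)) => //.
  - by move=> u'; rewrite mul1r hnorm_sqr.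
  - by move=> u1 u2; rewrite (linear_add Tlin) ipDl.
  - by move=> a u1; rewrite (linear_scale Tlin) ipZl.
  move=> u'; apply: le_trans (ip_abs_le _ _) _; rewrite mulrAC.
  rewrite ler_wpM2r ?hnorm_ge0//; apply: le_trans (hM u') _.
  by rewrite ler_wpM2r ?hnorm_ge0 ?ler_norm.
rewrite (@adjoint_uniq _ _ T v w) // => [|u']; first by rewrite -hw ipC.
by rewrite -hw ipC.
Qed.

Lemma inner_adjointC {U V} {T : U -> V} u v : bounded_operator T ->
  inner (adjoint T v) u = inner v (T u).
Proof.
move=> Tb; have := ip_inner_adjoint Tb.1 (fun u' => ip_adjoint Tb u' v) u.
rewrite (hermitian_subproof (T u)) (hermitian_subproof u) !expr0 !mul1r.
by move=> /(congr1 (@sconj R k)); rewrite !sconjK.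
Qed.

Lemma adjoint_linear {U V} {T : U -> V} : bounded_operator T -> linear (adjoint T).
Proof.
move=> Tb a v w; apply: ip_inj => u; rewrite !(ipC u) /ip.
by rewrite inner_adjointC// !linearPl /= !inner_adjointC.
Qed.

End Adjoint.

(** * Series indexed by a set of integers *)

Section Series.
Context {J : set int}.

(** The index set of the partial sum [partial_sums x mn]. *)
Definition window (mn : nat * nat) : set J :=
  [set j : J | - mn.1%:Z <= val j <= mn.2%:Z].

Lemma finite_window mn : finite_set (window mn).
Proof.
apply: (@finite_preimage _ _ [set z : int | - mn.1%:Z <= z <= mn.2%:Z] val).
  by move=> i j _ _; exact: val_inj.
apply: (@sub_finite_set _ _ ((fun i : nat => i%:Z - mn.1%:Z) @` `I_(mn.1 + mn.2).+1)).
  move=> z /= /andP[mz zn]; exists (absz (z + mn.1%:Z)) => /=; lia.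
by apply: finite_image; exact: finite_II.
Qed.

Lemma sub_window {mn pq : nat * nat} : (mn.1 <= pq.1)%N -> (mn.2 <= pq.2)%N ->
  window mn `<=` window pq.
Proof.
move=> h1 h2 j; rewrite /window /=; move: (\val j) => z /andP[mz zn]; lia.
Qed.

Lemma partial_sums_window {K : numFieldType} {W : normedModType K} (x : J -> W) mn :
  partial_sums x mn = \sum_(j \in window mn) x j.
Proof. by []. Qed.

Lemma fsum_additive {K L : numFieldType} {W : normedModType K} {X : normedModType L}
    (T : W -> X) (x : J -> W) {D : set J} : finite_set D ->
  (forall u v, T (u + v) = T u + T v) ->
  T (\sum_(j \in D) x j) = \sum_(j \in D) T (x j).
Proof.
move=> Dfin TD; rewrite !fsbig_finite//; apply: big_morph => //.
by apply: (addrI (T 0)); rewrite -TD !addr0.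
Qed.

Lemma fsum_setD {K : numFieldType} {W : normedModType K} (x : J -> W)
    {D A : set J} : finite_set D -> A `<=` D ->
  \sum_(j \in D) x j = \sum_(j \in A) x j + \sum_(j \in D `\` A) x j.
Proof. by move=> Dfin AD; rewrite (fsbigID A)//= setIidr// setDE. Qed.

Lemma le_fsum_subset {R : realType} {a : J -> R} {A D : set J} :
  (forall j, 0 <= a j) -> finite_set D -> A `<=` D ->
  \sum_(j \in A) a j <= \sum_(j \in D) a j.
Proof.
move=> a0 Dfin AD; rewrite [leRHS](fsum_setD a Dfin AD) lerDl.
by apply: fsumr_ge0.
Qed.

(** The windows are directed, so that a tail of the filter of pairs consists of
windows that contain a given one. *)
Lemma near_window (mn : nat * nat) :
  \forall pq \near filter_prod \oo \oo, window mn `<=` window pq.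
Proof.
exists ([set p | (mn.1 <= p)%N], [set q | (mn.2 <= q)%N]) => /=.
  by split; [exists mn.1|exists mn.2].
by move=> pq /= [h1 h2]; exact: sub_window.
Qed.

Lemma partial_sums_le {R : realType} {a : J -> R} {s} : (forall j, 0 <= a j) ->
  has_sum a s -> forall mn, partial_sums a mn <= s.
Proof.
move=> a0 sa mn; apply: (ler_cvg_to (cvg_cst _) sa).
apply: filterS (near_window mn) => pq h.
by rewrite !partial_sums_window le_fsum_subset//; exact: finite_window.
Qed.

Lemma has_sum_series_sum {K : numFieldType} {W : normedModType K} {x : J -> W} {s} :
  has_sum x s -> series_sum x = s.
Proof. by move=> xs; apply: cvg_lim => //; exact: norm_hausdorff. Qed.

Lemma has_sum_bounded {R : realType} {k : scalar_kind} {U V : hilbertType R k}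
   (T : U -> V) {x : J -> U} {s} : bounded_operator T -> has_sum x s ->
  has_sum (fun j => T (x j)) (T s).
Proof.
move=> /bounded_operatorP[Tlin [M hM]] /cvg_hnormP xs; apply/cvg_hnormP => e e0.
have c0 : 0 < `|M| + 1 by rewrite ltr_wpDl.
have := xs (e / (`|M| + 1)); rewrite divr_gt0// => /(_ isT); apply: filterS => mn.
rewrite ltr_pdivlMr// => h.
rewrite partial_sums_window -(fsum_additive T x (finite_window mn) (linear_add Tlin)).
rewrite -scaleN1r -(linear_scale Tlin) -(linear_add Tlin) scaleN1r.
apply: le_lt_trans (hM _) _; apply: le_lt_trans h.
rewrite mulrC ler_wpM2l ?hnorm_ge0//; have := ler_norm M; lra.
Qed.

Lemma has_sum_ip {R : realType} {k : scalar_kind} {U : hilbertType R k}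
   {x : J -> U} {s} (v : U) : has_sum x s -> has_sum (fun j => ip (x j) v) (ip s v).
Proof.
move=> /(cvg_ip v); apply: cvg_trans; apply: near_eq_cvg; apply: nearW => mn.
rewrite (partial_sums_window x) (fsum_additive (fun u => ip u v))//.
- exact: finite_window.
- by move=> u w; rewrite ipDl.
Qed.

Lemma has_sum_unique {K : numFieldType} {W : normedModType K} {x : J -> W} {s t} :
  has_sum x s -> has_sum x t -> s = t.
Proof. by move=> /has_sum_series_sum <- /has_sum_series_sum <-. Qed.

End Series.

(** * The frame operator *)

Section FrameOperator.
Context {R : realType} {k : scalar_kind} {U : hilbertType R k} {J : set int}
  {V : J -> hilbertType R k}.
Context {L : forall j : J, U -> V j} {A B : R}.
Hypothesis L_gframe : gframe L A B.

Let A_gt0 : 0 < A. Proof. by case: L_gframe. Qed.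
Let B_gt0 : 0 < B. Proof. by case: L_gframe. Qed.
Let L_bounded j : bounded_operator (L j). Proof. by case: L_gframe. Qed.

(** With [w] the sum on the left, its squared norm is a sum of inner products
of [L j f] with [L j w]; the positivity of the squared norms of
[B L_j f - L_j w] bounds it by sums of squares, and the upper frame bound at
[w] itself absorbs the terms with [L j w]. That [D] lies in a window makes it
finite and lets a partial sum dominate the sum over it. *)
Lemma bessel {D : set J} {mn} f : D `<=` window mn ->
  hnorm (\sum_(j \in D) adjoint (L j) (L j f)) ^+ 2 <=
  B * \sum_(j \in D) hnorm (L j f) ^+ 2.
Proof.
move=> Dmn; have Dfin := sub_finite_set Dmn (finite_window mn).
set w := \sum_(j \in D) _.
have wE : hnorm w ^+ 2 = \sum_(j \in D) ip (L j f) (L j w).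
  rewrite hnorm_sqr {1}/w (fsum_additive (fun u => ip u w))//; last first.
    by move=> u v; rewrite ipDl.
  by apply: eq_fsbigr => j _; rewrite ipC -ip_adjoint// ipC.
have wB : \sum_(j \in D) hnorm (L j w) ^+ 2 <= B * hnorm w ^+ 2.
  have [_ _ _ /(_ w)[s sw /andP[_ sB]]] := L_gframe.
  have a0 j : 0 <= hnorm (L j w) ^+ 2 by exact: sqr_ge0.
  apply: le_trans sB; apply: le_trans (partial_sums_le a0 sw mn).
  by rewrite partial_sums_window le_fsum_subset//; exact: finite_window.
suff : 2 * B * hnorm w ^+ 2 <=
    B ^+ 2 * \sum_(j \in D) hnorm (L j f) ^+ 2 + \sum_(j \in D) hnorm (L j w) ^+ 2.
  move=> h; rewrite -(ler_pM2l B_gt0); lra.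
rewrite wE !mulr_fsumr -fsbig_split//= !fsbig_finite//.
apply: ler_sum => j _; have := ip_ge0 (rscalar B *: L j f - L j w).
by rewrite !ipE (ipC (L j w)) -!hnorm_sqr; lra.
Qed.

(** By [bessel] the increments of the vector series are controlled by those of
the convergent series of squared norms. *)
Lemma gframe_summable f : summable_series (fun j => adjoint (L j) (L j f)).
Proof.
have [_ _ _ /(_ f)[s sf _]] := L_gframe.
have a0 j : 0 <= hnorm (L j f) ^+ 2 by exact: sqr_ge0.
apply: hnorm_cauchy_cvg => e e0.
have eB0 : 0 < e ^+ 2 / B by rewrite divr_gt0// exprn_gt0.
have /cvgrPdist_lt /(_ _ eB0) h := sf.
have [mn hmn] := filter_ex h.
exists (partial_sums (fun j => adjoint (L j) (L j f)) mn).
apply: filterS (near_window (J := J) mn) => pq mnpq.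
rewrite !partial_sums_window (fsum_setD _ (finite_window pq) mnpq).
rewrite opprD addrA subrr add0r hnorm_opp.
rewrite -(@ltr_pXn2r _ 2) ?nnegrE ?hnorm_ge0 ?(ltW e0)//.
apply: le_lt_trans (bessel (mn := pq) f _) _; first exact: subDsetl.
rewrite mulrC -ltr_pdivlMr//; apply: le_lt_trans hmn.
apply: le_trans (ler_norm _); rewrite lerBrDl partial_sums_window.
by rewrite -(fsum_setD _ (finite_window pq) mnpq) (partial_sums_le a0 sf).
Qed.

Local Notation S := (gframe_operator L).

Lemma has_sum_gframe_operator f : has_sum (fun j => adjoint (L j) (L j f)) (S f).
Proof. exact: gframe_summable. Qed.

Lemma has_sum_ip_gframe f g : has_sum (fun j => ip (L j f) (L j g)) (ip (S f) g).
Proof.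
have := has_sum_ip g (has_sum_gframe_operator f); congr (has_sum _ _).
by apply: funext => j; rewrite ipC -ip_adjoint// ipC.
Qed.

Lemma has_sum_quadratic f : has_sum (fun j => hnorm (L j f) ^+ 2) (ip (S f) f).
Proof.
have := has_sum_ip_gframe f f; congr (has_sum _ _).
by apply: funext => j; rewrite hnorm_sqr.
Qed.

Lemma gframe_coercive f : A * hnorm f ^+ 2 <= ip (S f) f.
Proof.
have [_ _ _ /(_ f)[s sf /andP[sA _]]] := L_gframe.
by rewrite (has_sum_unique (has_sum_quadratic f) sf).
Qed.

Lemma gframe_upper f : ip (S f) f <= B * hnorm f ^+ 2.
Proof.
have [_ _ _ /(_ f)[s sf /andP[_ sB]]] := L_gframe.
by rewrite (has_sum_unique (has_sum_quadratic f) sf).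
Qed.

Lemma gframe_operator_sym f g : ip (S f) g = ip f (S g).
Proof.
rewrite (ipC f); apply: (has_sum_unique (has_sum_ip_gframe f g)).
have := has_sum_ip_gframe g f; congr (has_sum _ _).
by apply: funext => j; rewrite ipC.
Qed.

(** Linearity passes to the limit from the partial sums; symmetry for [ip]
would only give it for real scalars. *)
Lemma gframe_operator_linear : linear S.
Proof.
move=> a u v; apply: has_sum_unique (has_sum_gframe_operator _) _.
have : (a *: partial_sums (fun j => adjoint (L j) (L j u)) mn +
    partial_sums (fun j => adjoint (L j) (L j v)) mn) @[mn --> filter_prod \oo \oo]
    --> a *: S u + S v.
  by apply: cvgD; [apply: cvgZl_tmp|]; exact: has_sum_gframe_operator.
apply: cvg_trans; apply: near_eq_cvg; apply: nearW => mn.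
rewrite !partial_sums_window !fsbig_finite; try exact: finite_window.
rewrite scaler_sumr -big_split; apply: eq_bigr => j _ /=.
by rewrite (L_bounded j).1 (adjoint_linear (L_bounded j)).
Qed.

(** The limit of [bessel] over growing windows; as an inequality between
quadratic forms it reads [S ^+ 2 <= B S]. *)
Lemma gframe_operator_sqr_le f : hnorm (S f) ^+ 2 <= B * ip (S f) f.
Proof.
have Sf0 : 0 <= ip (S f) f.
  by apply: le_trans (gframe_coercive f); rewrite mulr_ge0 ?sqr_ge0// ltW.
rewrite -(@sqr_sqrtr _ (B * ip (S f) f)); last by rewrite mulr_ge0// ltW.
rewrite ler_pXn2r ?nnegrE ?hnorm_ge0 ?sqrtr_ge0//; apply/ler_addgt0Pr => e e0.
have /cvg_hnormP /(_ _ e0) /filter_ex[mn Sfe] := has_sum_gframe_operator f.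
set P := partial_sums _ mn in Sfe.
rewrite -{1}[S f](subrK P).
apply: le_trans (hnorm_triangle _ _) _; rewrite addrC lerD ?(ltW Sfe)//.
rewrite -[hnorm P](ger0_norm (hnorm_ge0 _)) -sqrtr_sqr ler_wsqrtr//.
apply: le_trans (bessel f (@subset_refl _ _)) _.
rewrite ler_wpM2l ?(ltW B_gt0)//.
exact: (partial_sums_le (fun j => sqr_ge0 _) (has_sum_quadratic f) mn).
Qed.

Lemma gframe_operator_le f : hnorm (S f) <= B * hnorm f.
Proof.
suff : hnorm (S f) ^+ 2 <= (B * hnorm f) ^+ 2.
  by rewrite ler_pXn2r ?nnegrE ?hnorm_ge0// mulr_ge0 ?hnorm_ge0// ltW.
apply: le_trans (gframe_operator_sqr_le f) _.
by rewrite exprMn (expr2 B) -mulrA ler_wpM2l ?gframe_upper ?(ltW B_gt0).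
Qed.

Lemma gframe_operator_bounded : bounded_operator S.
Proof.
apply/bounded_operatorP; split; first exact: gframe_operator_linear.
by exists B => u; exact: gframe_operator_le.
Qed.

Lemma gframe_lower_norm f : A * hnorm f <= hnorm (S f).
Proof.
have [/hnorm_eq0 ->|f0] := eqVneq (hnorm f) 0.
  by rewrite /hnorm normr0 -rscalar0 rscalarK mulr0; exact: hnorm_ge0.
have f_gt0 : 0 < hnorm f by rewrite lt_def f0 hnorm_ge0.
rewrite -(ler_pM2r f_gt0) -mulrA -expr2.
exact: le_trans (gframe_coercive f) (ip_le _ _).
Qed.

Lemma gframe_operator_inj : injective S.
Proof.
move=> u v Suv; apply/eqP; rewrite -subr_eq0; apply/eqP/hnorm_eq0/eqP.
rewrite eq_le hnorm_ge0 andbT -(ler_pM2l A_gt0) mulr0.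
apply: le_trans (gframe_lower_norm _) _.
rewrite -scaleN1r addrC gframe_operator_linear Suv scaleN1r addNr.
by rewrite /hnorm normr0 -rscalar0 rscalarK.
Qed.

(** [lax_milgram] for [S], coercive with the lower frame bound as constant. *)
Lemma gframe_operator_surj v : exists u, S u = v.
Proof.
have [u uv] : exists u, forall w, ip (S u) w = ip v w.
  have Slin := gframe_operator_linear.
  apply: (@lax_milgram R k U S A (ip v) (hnorm v)) => //.
  - exact: linear_add.
  - by move=> a u; rewrite (linear_scale Slin).
  - exact: gframe_operator_sym.
  - exact: gframe_coercive.
  - by move=> u w; rewrite ipDr.
  - by move=> a u; rewrite ipZr.
  - by move=> u; exact: ip_abs_le.
by exists u; apply: ip_inj => w; rewrite ipC uv ipC.
Qed.

End FrameOperator.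

(** * The canonical dual frame *)

Section Inverse.
Context {R : realType} {k : scalar_kind} {U : hilbertType R k}.

Lemma operator_invE {T T' : U -> U} : cancel T T' -> cancel T' T ->
  operator_inv T = T'.
Proof.
move=> TK T'K; apply: funext => v; rewrite /operator_inv.
case: xgetP => [u _ /= <-|/(_ (T' v))[]]; first by rewrite TK.
exact: T'K.
Qed.

Lemma operator_norm_le {V : hilbertType R k} (T : U -> V) (M : R) : 0 <= M ->
  (forall u, hnorm (T u) <= M * hnorm u) -> operator_norm T <= M.
Proof.
move=> M0 hM; apply: ge_sup.
  by exists (hnorm (T 0)), 0 => //=; rewrite /hnorm normr0 -rscalar0 rscalarK.
by move=> _ [u /= u1 <-]; apply: le_trans (hM u) _; rewrite -[leRHS]mulr1 ler_wpM2l.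
Qed.

End Inverse.

Section CanonicalDual.
Context {R : realType} {k : scalar_kind} {U : hilbertType R k} {J : set int}
  {V : J -> hilbertType R k}.
Context {L : forall j : J, U -> V j} {A B : R}.
Hypothesis L_gframe : gframe L A B.

Let A_gt0 : 0 < A. Proof. by case: L_gframe. Qed.
Let B_gt0 : 0 < B. Proof. by case: L_gframe. Qed.
Let L_bounded j : bounded_operator (L j). Proof. by case: L_gframe. Qed.

Local Notation S := (gframe_operator L).
Local Notation Sinv := (operator_inv S).
Local Notation tL := (fun j : J => L j \o Sinv).

Lemma gframe_operator_invK : cancel Sinv S.
Proof.
move=> v; rewrite /operator_inv; case: xgetP => [u _ //|nu].
by have [u /nu] := gframe_operator_surj L_gframe v.
Qed.

Lemma gframe_operatorK : cancel S Sinv.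
Proof.
by move=> u; apply: (gframe_operator_inj L_gframe); rewrite gframe_operator_invK.
Qed.

Lemma gframe_inv_linear : linear Sinv.
Proof.
move=> a u v; apply: (gframe_operator_inj L_gframe).
by rewrite (gframe_operator_linear L_gframe) !gframe_operator_invK.
Qed.

Lemma gframe_inv_le f : hnorm (Sinv f) <= 1 / A * hnorm f.
Proof.
rewrite mulrC mul1r ler_pdivlMr// mulrC.
by have := gframe_lower_norm L_gframe (Sinv f); rewrite gframe_operator_invK.
Qed.

Lemma gframe_inv_bounded : bounded_operator Sinv.
Proof.
apply/bounded_operatorP; split; first exact: gframe_inv_linear.
by exists (1 / A) => u; exact: gframe_inv_le.
Qed.

Lemma gframe_inv_sym f g : ip (Sinv f) g = ip f (Sinv g).
Proof.
rewrite -{1}(gframe_operator_invK g) -(gframe_operator_sym L_gframe).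
by rewrite gframe_operator_invK.
Qed.

Lemma dual_bounded j : bounded_operator (tL j).
Proof.
have /bounded_operatorP[Llin [M hM]] := L_bounded j.
have /bounded_operatorP[Slin [N hN]] := gframe_inv_bounded.
apply/bounded_operatorP; split; first by move=> a u v /=; rewrite Slin Llin.
exists (`|M| * N) => u /=; apply: le_trans (hM _) _.
apply: (@le_trans _ _ (`|M| * hnorm (Sinv u))).
  by rewrite ler_wpM2r ?hnorm_ge0 ?ler_norm.
by rewrite -mulrA ler_wpM2l.
Qed.

(** Taking adjoints reverses the composition, and [Sinv] is symmetric. *)
Lemma adjoint_dual j v : adjoint (tL j) v = Sinv (adjoint (L j) v).
Proof.
apply: adjoint_uniq => [|u /=]; first exact: (dual_bounded j).1.
by rewrite ip_adjoint// gframe_inv_sym.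
Qed.

Lemma has_sum_synthesis_dual f : has_sum (fun j => adjoint (L j) (tL j f)) f.
Proof.
have := has_sum_gframe_operator L_gframe (Sinv f).
by rewrite gframe_operator_invK.
Qed.

Lemma has_sum_dual_synthesis f : has_sum (fun j => adjoint (tL j) (L j f)) f.
Proof.
have := has_sum_bounded _ gframe_inv_bounded (has_sum_gframe_operator L_gframe f).
rewrite gframe_operatorK; congr (has_sum _ _).
by apply: funext => j; rewrite adjoint_dual.
Qed.

(** This is [has_sum_dual_synthesis] at the vector [Sinv f]. *)
Lemma has_sum_dual_operator f : has_sum (fun j => adjoint (tL j) (tL j f)) (Sinv f).
Proof. exact: has_sum_dual_synthesis. Qed.

(** The squared norms add up to [ip f (Sinv f)]. The upper bound is the norm
bound of [Sinv]; the lower one is [gframe_operator_sqr_le] at [Sinv f]. *)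
Lemma dual_gframe : gframe tL (1 / B) (1 / A).
Proof.
split; [exact: divr_gt0|exact: divr_gt0|exact: dual_bounded|move=> f].
exists (ip (S (Sinv f)) (Sinv f)); first exact: (has_sum_quadratic L_gframe).
apply/andP; split.
  rewrite mulrC mul1r ler_pdivrMr// mulrC.
  have := gframe_operator_sqr_le L_gframe (Sinv f).
  by rewrite gframe_operator_invK.
rewrite gframe_operator_invK; apply: le_trans (ip_le _ _) _.
rewrite expr2 mulrA mulrC ler_wpM2r ?hnorm_ge0//; exact: gframe_inv_le.
Qed.

Lemma dual_gframe_operator : gframe_operator tL = Sinv.
Proof. by apply: funext => f; apply: has_sum_series_sum; exact: has_sum_dual_operator. Qed.

End CanonicalDual.

(** * The theorem *)

Theorem mainTheorem2 (R : realType) (k : scalar_kind) (U : hilbertType R k)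
    (J : set int) (V : J -> hilbertType R k)
    (Lambda : forall j : J, U -> V j) (A B : R)
    (Lambda_gframe : gframe Lambda A B) :
  let S := gframe_operator Lambda in
  let Sinv := operator_inv S in
  let tLambda := fun j : J => Lambda j \o Sinv in
  let tS := gframe_operator tLambda in
  (* the series defining S converges; properties of S *)
  [/\ forall f : U,
        summable_series (fun j : J => adjoint (Lambda j) (Lambda j f)),
      bounded_operator S,
      self_adjoint S,
      invertible_operator S &
      operator_norm S <= B /\ operator_norm Sinv <= 1 / A] /\
  (* (a) *)
  (forall f : U,
     has_sum (fun j : J => adjoint (Lambda j) (tLambda j f)) f /\
     has_sum (fun j : J => adjoint (tLambda j) (Lambda j f)) f) /\
  (* (b) *)
  gframe tLambda (1 / B) (1 / A) /\
  (* (c) *)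
  [/\ forall f : U,
        summable_series (fun j : J => adjoint (tLambda j) (tLambda j f)),
      tS = Sinv &
      forall j : J, tLambda j \o operator_inv tS = Lambda j].
Proof.
move=> S Sinv tLambda tS.
have Sb := gframe_operator_bounded Lambda_gframe.
have Sinvb := gframe_inv_bounded Lambda_gframe.
have SK := gframe_operatorK Lambda_gframe.
have SinvK := gframe_operator_invK Lambda_gframe.
have [A0 B0 _ _] := Lambda_gframe.
have tSE : tS = Sinv := dual_gframe_operator Lambda_gframe.
split; [split|split; [|split; [|split]]] => //.
- exact: (gframe_summable Lambda_gframe).
- move=> u v; apply: ip_inner_adjoint => [|w]; first exact: Sb.1.
  exact: (gframe_operator_sym Lambda_gframe).
- by exists Sinv.
- split; apply: operator_norm_le.
  + exact: ltW.
  + exact: (gframe_operator_le Lambda_gframe).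
  + by rewrite divr_ge0// ltW.
  + exact: (gframe_inv_le Lambda_gframe).
- move=> f; split; first exact: (has_sum_synthesis_dual Lambda_gframe).
  exact: (has_sum_dual_synthesis Lambda_gframe).
- exact: (dual_gframe Lambda_gframe).
- by move=> f; apply/cvg_ex; exists (Sinv f); exact: (has_sum_dual_operator Lambda_gframe).
- move=> j; apply: funext => u; rewrite tSE (operator_invE SinvK SK).
  by rewrite /tLambda /Sinv /S /= SK.
Qed.
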